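(* Let $G$ be a weakly connected and weight-balanced weighted directed graph on $N\ge2$ nodes with Laplacian matrix $L$, and let $\Delta>0$. Consider the hybrid system (H) of consensus with hysteretic quantizers described in the context, and let $z=(x,q)$ be its complete solution with initial condition $z(0,0)=(x(0,0),q(0,0))\in X_0$. Put $$T=\frac{\Delta/2}{\|L\|_\infty\,(\|q(0,0)\|_\infty+\Delta/2)},\qquad B=\left\lceil\log_2\!\left(8\,\frac{\|q(0,0)\|_\infty}{\Delta}+5\right)\right\rceil .$$ Then for each agent $i\in V$: (1) any two consecutive times at which $q_i$ changes its value are at least $T$ apart; (2) the values taken by $q_i(t,j)$, $(t,j)\in\mathrm{dom}\,z$, can be encoded with $B$ bits, i.e. $q_i$ takes at most $2^B$ distinct values. Consequently, if each agent transmits its quantized state $q_i$ encoded in $B$ bits each time it changes value, each agent transmits at a data rate (number of bits per transmission divided by the minimal time between consecutive transmissions) not larger than $$\frac BT=\left\lceil\log_2\!\left(8\,\frac{\|q(0,0)\|_\infty}{\Delta}+5\right)\right\rceil\left(2\,\frac{\|q(0,0)\|_\infty}{\Delta}+1\right)\|L\|_\infty .$$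
   Context: A weighted directed graph $G=(V,E,A)$ has node set $V=\{1,\dots,N\}$ (the agents), edge set $E\subset V\times V$ without self-loops, and adjacency matrix $A\in\mathbb{R}_{\ge0}^{N\times N}$ with $A_{ij}>0$ if $(j,i)\in E$ and $A_{ij}=0$ otherwise. It is weight-balanced if $\sum_j A_{ij}=\sum_j A_{ji}$ for every $i$; weakly connected if any two nodes are joined by a path of edges, disregarding orientation. $L=\mathrm{diag}(A\mathbf 1)-A$ is the Laplacian, with $\mathbf 1$ the all-ones vector. $\|\cdot\|_\infty$ is the max norm of vectors and the induced matrix norm (maximal absolute row sum). Hybrid system (H). Let $Q=\Delta\mathbb{Z}\cup(\Delta\mathbb{Z}+\Delta/2)$ and $X=\mathbb{R}^N\times Q^N$, with states $z=(x,q)$. Let $C=\{(x,q)\in X:\ q_i-\frac\Delta2<x_i<q_i+\frac\Delta2\ \forall i\in V\}$ and $D=X\setminus C$, i.e. $D=\{(x,q)\in X:\exists i\in V,\ x_i\le q_i-\frac\Delta2\text{ or }x_i\ge q_i+\frac\Delta2\}$. On $C$ the state flows: $\dot z=f(z)$, i.e. $\dot x=-Lq$, $\dot q=0$. On $D$ the state jumps: $z^+=g(z)$, i.e. $x^+=x$ and, for each $i$, $q_i^+=q_i+\frac\Delta2$ if $x_i\ge q_i+\frac\Delta2$, $q_i^+=q_i-\frac\Delta2$ if $x_i\le q_i-\frac\Delta2$, $q_i^+=q_i$ otherwise. Initial conditions belong to $X_0=\{(x,q)\in X:\ q_i-\frac\Delta2\le x_i<q_i+\frac\Delta2\ \forall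 i\in V\}$. A hybrid time domain is a subset of $\mathbb{R}_{\ge0}\times\mathbb{N}$ that is the union of infinitely many intervals $[t_j,t_{j+1}]\times\{j\}$, $j=0,1,2,\dots$, with $0=t_0\le t_1\le t_2\le\cdots$, or of finitely many such intervals, with the last one possibly of the form $[t_j,t_{j+1}]\times\{j\}$, $[t_j,t_{j+1})\times\{j\}$ or $[t_j,+\infty)\times\{j\}$. A solution is a function $z(t,j)$ defined on a hybrid time domain $\mathrm{dom}\,z$, such that $t\mapsto z(t,j)$ is locally absolutely continuous on $I_j=\{t:(t,j)\in\mathrm{dom}\,z\}$ for each $j$, $z(0,0)\in C\cup D$, and: (a) for each $j$ such that $I_j$ has nonempty interior, $\dot z(t,j)=f(z(t,j))$ for a.e. $t\in I_j$ and $z(t,j)\in C$ for all $t\in[\min I_j,\sup I_j)$; (b) for each $(t,j)\in\mathrm{dom}\,z$ with $(t,j+1)\in\mathrm{dom}\,z$, $z(t,j)\in D$ and $z(t,j+1)=g(z(t,j))$. A solution is complete if $\mathrm{dom}\,z$ is unbounded; for every initial condition in $X_0$ a complete solution exists and is unique. The value $q_i$ changes at time $t$ if there is $j$ with $(t,j),(t,j+1)\in\mathrm{dom}\,z$ and $q_i(t,j+1)\ne q_i(t,j)$. *)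

(* Defs.v *)
From HB Require Import structures.
From mathcomp Require Import all_boot all_order all_algebra.
From mathcomp Require Import all_classical all_reals all_analysis.

Set Implicit Arguments.
Unset Strict Implicit.
Unset Printing Implicit Defensive.

Import Order.TTheory GRing.Theory Num.Theory.
Import numFieldNormedType.Exports.

Local Open Scope classical_set_scope.
Local Open Scope ring_scope.

(* [edge j i] is (j, i) \in E: agent [i] listens to agent [j], with weight
   [adj i j]. *)
Record wdigraph (R : realType) (N : nat) := WDigraph {
  edge : rel 'I_N ;
  adj : 'M[R]_N ;
  edge_irr : irreflexive edge ;
  adj_gt0 : forall i j, edge j i -> 0 < adj i j ;
  adj_eq0 : forall i j, ~~ edge j i -> adj i j = 0
}.

Definition weight_balanced (R : realType) (N : nat) (G : wdigraph R N) : Prop :=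
  forall i, \sum_j adj G i j = \sum_j adj G j i.

Definition weakly_connected (R : realType) (N : nat) (G : wdigraph R N) : Prop :=
  forall i j, connect [rel u v | edge G u v || edge G v u] i j.

Definition laplacian (R : realType) (N : nat) (G : wdigraph R N) : 'M[R]_N :=
  diag_mx (adj G *m const_mx 1)^T - adj G.

(* The matrix norm induced by the max norm.  The norm [`| A |] of a matrix in
   the library is the largest absolute value of an entry; it is the max norm on
   column vectors, but not the induced norm on matrices. *)
Definition row_sum_norm (R : realType) (m n : nat) (A : 'M[R]_(m, n)) : R :=
  \big[Num.max/0]_i \sum_j `|A i j|.

(* A pair (x, q); the constraint that the entries of [q] lie in the quantization
   grid is carried by [state_space]. *)
Notation state R N := ('cV[R]_N * 'cV[R]_N)%type.

Definition grid (R : realType) (Delta : R) : set R :=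
  [set r | exists k : int, r = Delta * k%:~R \/ r = Delta * k%:~R + Delta / 2].

Definition state_space (R : realType) (N : nat) (Delta : R) : set (state R N) :=
  [set z : state R N | forall i, grid Delta (z.2 i 0)].

Definition flow_set (R : realType) (N : nat) (Delta : R) : set (state R N) :=
  [set z : state R N | state_space Delta z /\
     forall i, z.2 i 0 - Delta / 2 < z.1 i 0 < z.2 i 0 + Delta / 2].

Definition jump_set (R : realType) (N : nat) (Delta : R) : set (state R N) :=
  @state_space R N Delta `\` @flow_set R N Delta.

Definition initial_set (R : realType) (N : nat) (Delta : R) :
    set (state R N) :=
  [set z : state R N | state_space Delta z /\
     forall i, z.2 i 0 - Delta / 2 <= z.1 i 0 < z.2 i 0 + Delta / 2].

Definition flow_map (R : realType) (N : nat) (L : 'M[R]_N) (z : state R N) :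
    state R N :=
  (- (L *m z.2), 0).

Definition jump_map (R : realType) (N : nat) (Delta : R) (z : state R N) :
    state R N :=
  (z.1,
   \col_i (if z.2 i 0 + Delta / 2 <= z.1 i 0 then z.2 i 0 + Delta / 2
           else if z.1 i 0 <= z.2 i 0 - Delta / 2 then z.2 i 0 - Delta / 2
           else z.2 i 0)).

Definition hybrid_time_domain (R : realType) (E : set (R * nat)) : Prop :=
  exists t : nat -> R,
    [/\ t 0%N = 0,
        (forall j, t j <= t j.+1) &
        E = \bigcup_(j in [set: nat]) (`[t j, t j.+1]%classic `*` [set j])
        \/ exists (J : nat) (I : set R),
             [\/ I = `[t J, t J.+1]%classic, I = `[t J, t J.+1[%classic
               | I = `[t J, +oo[%classic]
             /\ E = \bigcup_(j in `I_J) (`[t j, t j.+1]%classic `*` [set j])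
                    `|` (I `*` [set J])].

Definition time_slice (R : realType) (E : set (R * nat)) (j : nat) : set R :=
  [set t | E (t, j)].

Definition abs_continuous (R : realType) (V : normedModType R) (a b : R)
    (f : R -> V) : Prop :=
  forall e : R, 0 < e -> exists2 d : R, 0 < d &
    forall (n : nat) (u v : nat -> R),
      (forall k, (k < n)%N -> [/\ a <= u k, u k <= v k & v k <= b]) ->
      trivIset `I_n (fun k => `]u k, v k[%classic) ->
      \sum_(k < n) (v k - u k) < d ->
      \sum_(k < n) `|f (v k) - f (u k)| < e.

Definition loc_abs_continuous (R : realType) (V : normedModType R) (I : set R)
    (f : R -> V) : Prop :=
  forall a b : R, a <= b -> `[a, b]%classic `<=` I -> abs_continuous a b f.

(* A solution is a total function [z], of which only the values on the domain
   [E] are constrained.  In [sol_flow] the derivative is two-sided, so that at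
   an end point of the time interval it may involve values off the domain; end
   points form a null set and are discarded by the quantifier "almost
   everywhere".  The clause [t < sup I_j] is stated in the extended reals because
   I_j may be unbounded. *)
Record hybrid_solution (R : realType) (N : nat) (L : 'M[R]_N) (Delta : R)
    (E : set (R * nat)) (z : R -> nat -> state R N) : Prop := HybridSolution {
  sol_dom : hybrid_time_domain E ;
  sol_dom0 : E (0, 0%N) ;
  sol_state : forall t j, E (t, j) -> state_space Delta (z t j) ;
  sol_init : (flow_set Delta `|` jump_set Delta) (z 0 0%N) ;
  sol_abs_cont : forall j,
    loc_abs_continuous (time_slice E j) (fun t => z t j) ;
  sol_flow : forall j, interior (time_slice E j) !=set0 ->
    {ae lebesgue_measure, forall t : R, time_slice E j t ->
       is_derive t 1 (fun s : R => z s j) (flow_map L (z t j))} ;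
  sol_flow_set : forall j, interior (time_slice E j) !=set0 ->
    forall t, time_slice E j t ->
      (t%:E < ereal_sup (EFin @` time_slice E j))%E ->
      flow_set Delta (z t j) ;
  sol_jump : forall t j, E (t, j) -> E (t, j.+1) ->
    jump_set Delta (z t j) /\ z t j.+1 = jump_map Delta (z t j)
}.

Definition complete_domain (R : realType) (E : set (R * nat)) : Prop :=
  forall M : R, exists2 p, E p & M < p.1 \/ M < p.2%:R.

Definition q_changes (R : realType) (N : nat) (E : set (R * nat))
    (z : R -> nat -> state R N) (i : 'I_N) (t : R) (j : nat) : Prop :=
  [/\ E (t, j), E (t, j.+1) & (z t j.+1).2 i 0 <> (z t j).2 i 0].

Definition q_change_time (R : realType) (N : nat) (E : set (R * nat))
    (z : R -> nat -> state R N) (i : 'I_N) (t : R) : Prop :=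
  exists j, q_changes E z i t j.

Definition consecutive_change_times (R : realType) (N : nat) (E : set (R * nat))
    (z : R -> nat -> state R N) (i : 'I_N) (s t : R) : Prop :=
  [/\ q_change_time E z i s, q_change_time E z i t, s < t &
      forall r, s < r < t -> ~ q_change_time E z i r].

Definition q_values (R : realType) (N : nat) (E : set (R * nat))
    (z : R -> nat -> state R N) (i : 'I_N) : set R :=
  [set (z p.1 p.2).2 i 0 | p in E].

(* A transmission takes place at every jump (t, j) -> (t, j + 1) at which q_i
   changes.  Two transmissions at the same time t and different j are distinct:
   the delay between them is 0. *)
Definition consecutive_transmissions (R : realType) (N : nat)
    (E : set (R * nat)) (z : R -> nat -> state R N) (i : 'I_N) (s t : R) : Prop :=
  exists j k : nat,
    [/\ q_changes E z i s j, q_changes E z i t k, (j < k)%N &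
        forall r l, (j < l < k)%N -> ~ q_changes E z i r l].

(* This is +oo for an agent that transmits at most once. *)
Definition min_transmission_delay (R : realType) (N : nat) (E : set (R * nat))
    (z : R -> nat -> state R N) (i : 'I_N) : \bar R :=
  ereal_inf [set d | exists s t : R,
    consecutive_transmissions E z i s t /\ d = (t - s)%:E].

(* The inverse in [\bar R] sends 0 to +oo and +oo to 0. *)
Definition data_rate (R : realType) (N : nat) (bits : nat) (E : set (R * nat))
    (z : R -> nat -> state R N) (i : 'I_N) : \bar R :=
  (bits%:R%:E * (min_transmission_delay E z i)^-1)%E.

Definition log2 (R : realType) (r : R) : R := ln r / ln 2.

(* [Num.ceil] is an integer; it is positive here, since its argument is at least
   log2 5, so that taking the absolute value only converts it to [nat]. *)
Definition num_bits (R : realType) (N : nat) (Delta : R) (q0 : 'cV[R]_N) : nat :=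
  `|Num.ceil (log2 (8 * (`|q0| / Delta) + 5))|%N.

Definition dwell_time (R : realType) (N : nat) (L : 'M[R]_N) (Delta : R)
    (q0 : 'cV[R]_N) : R :=
  (Delta / 2) / (row_sum_norm L * (`|q0| + Delta / 2)).

(* Main.v *)
Require Import Defs.
From mathcomp Require Import all_boot all_order all_algebra.
From mathcomp Require Import all_classical all_reals all_analysis.
From mathcomp Require Import lra ring zify.
Set Implicit Arguments.
Unset Strict Implicit.
Unset Printing Implicit Defensive.

Import Order.TTheory GRing.Theory Num.Theory.
Import numFieldNormedType.Exports.
Local Open Scope classical_set_scope.
Local Open Scope ring_scope.

(* Let K be the max norm of q(0,0).  A saturated agent jumps onto q_i = x_i, so
   before its next change x_i travels at least Delta/2, at a speed bounded by
   the row sum norm of L times the norm of q; this gives the dwell time once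
   |q_i| <= K + Delta/2 is known.  That bound is a maximum principle: the rows
   of L sum to 0 and its off-diagonal entries are nonpositive, so x_i cannot
   increase while q_i is maximal.  The extra Delta/2 arises below only, because
   X_0 allows x_i = q_i - Delta/2, hence an initial downward jump, but not
   x_i = q_i + Delta/2.  Writing K = a Delta/2, the values of q_i are among
   2a + 2 points of the grid, and 2a + 2 <= 4a + 5 <= 2^B. *)

(** * Absolutely continuous functions with a derivative that is constant almost everywhere *)

(** Take for [c] the supremum of the points of [a, b] where [P] holds: the step carries [P] across
    [c], either to [b] or strictly beyond the supremum. *)
Lemma real_induction (R : realType) (P : R -> Prop) (a b : R) :
  a <= b -> P a ->
  (forall c, a <= c <= b -> exists2 d : R, 0 < d & forall s t,
    a <= s -> s <= c -> c <= t -> t <= b -> c - d < s -> t < c + d ->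
    P s -> P t) ->
  P b.
Proof.
move=> ab Pa step.
pose S := [set t | a <= t <= b /\ P t].
have Sa : S a by split=> //; rewrite lexx.
have supS : has_sup S.
  by split; [exists a | exists b => t [/andP[]]].
have /andP[ac cb] : a <= sup S <= b.
  apply/andP; split; first exact: ub_le_sup supS.2 _ Sa.
  by apply: ge_sup; [exists a | move=> t [/andP[]]].
have [|d d0 stepc] := step (sup S); first by rewrite ac cb.
have [s [/andP[as_ sb] Ps] cs] := sup_adherent d0 supS.
have sc : s <= sup S by apply: ub_le_sup supS.2 _ _; split=> //; rewrite as_ sb.
have [ltb|leb] := ltP b (sup S + d); first exact: (stepc s).
have : S (sup S + d / 2).
  split; first by apply/andP; split; lra.
  by apply: (stepc s) => //; lra.
by move=> /(ub_le_sup supS.2) ?; lra.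
Qed.

Lemma negligible_open_cover (R : realType) (Z : set R) (e : R) :
  lebesgue_measure.-negligible Z -> 0 < e ->
  exists U : set R, [/\ open U, Z `<=` U & (lebesgue_measure U < e%:E)%E].
Proof.
move=> [A [mA A0 ZA]] e0.
have [|U [oU AU UA]] := lebesgue_regularity_outer mA _ e0.
  by rewrite [X in (X < _)%E]A0.
exists U; split=> //; first exact: subset_trans AU.
have mU : measurable U by exact: measurable_realfun.open_measurable.
have UDI : lebesgue_measure U =
    (lebesgue_measure (U `\` A) + lebesgue_measure (U `&` A))%E.
  exact: measureDI.
rewrite UDI setIidr// A0.
by rewrite adde0.
Qed.

Lemma sum_disjoint_itv_le (R : realType) (n : nat) (u v : nat -> R)
    (U : set R) :
  measurable U ->
  (forall k, (k < n)%N -> u k <= v k) ->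
  (forall k, (k < n)%N -> `]u k, v k[%classic `<=` U) ->
  trivIset `I_n (fun k => `]u k, v k[%classic) ->
  ((\sum_(k < n) (v k - u k))%:E <= lebesgue_measure U)%E.
Proof.
move=> mU uv uvU tI.
have mI k : (k < n)%N -> measurable (`]u k, v k[%classic : set R).
  by move=> _; exact: measurable_itv.
have mB : measurable (\big[setU/set0]_(k < n) (`]u k, v k[%classic : set R)).
  by apply: bigsetU_measurable => k _; exact: measurable_itv.
have sU : \big[setU/set0]_(k < n) `]u k, v k[%classic `<=` U.
  rewrite -(bigcup_mkord n (fun k => `]u k, v k[%classic)).
  by move=> x [k kn]; exact: uvU.
have muB : (lebesgue_measure (\big[setU/set0]_(k < n) `]u k, v k[%classic) =
    \sum_(k < n) lebesgue_measure (`]u k, v k[%classic : set R))%E.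
  exact: (measure_semi_additive_ord_I
    (lebesgue_measure : {measure set (measurableTypeR R) -> \bar R}) mI tI mB).
have -> : ((\sum_(k < n) (v k - u k))%:E =
    lebesgue_measure (\big[setU/set0]_(k < n) `]u k, v k[%classic))%E.
  rewrite muB -sumEFin; apply: eq_bigr => k _.
  rewrite lebesgue_measure_itv /= lte_fin; case: ltP => // vu.
  have := uv k (ltn_ord k) => uvk; congr _%:E; lra.
apply: le_measure; rewrite ?inE//.
Qed.

(* Real induction moves a point [t] from [a] to [b]; whenever it meets a point
   of the exceptional null set, the interval just crossed lies in an open set of
   small measure, and absolute continuity controls the total variation over all
   these intervals. *)
Lemma abs_continuous_ae_affine (R : realType) (V : normedModType R) (a b : R)
    (f : R -> V) (w : V) (Z : set R) :
  a <= b -> abs_continuous a b f -> lebesgue_measure.-negligible Z ->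
  (forall t, a <= t <= b -> ~ Z t -> forall e : R, 0 < e ->
     exists2 d : R, 0 < d & forall y, `|y - t| < d ->
       `|f y - f t - (y - t) *: w| <= e * `|y - t|) ->
  f b - f a = (b - a) *: w.
Proof.
move=> ab acf Z0 df.
(* The defect of [f] from slope [w] on [s, t], subadditive under concatenation of intervals. *)
pose D s t := `|f t - f s - (t - s) *: w|.
have D_le s t : s <= t -> D s t <= `|f t - f s| + (t - s) * `|w|.
  move=> st; apply: le_trans (ler_normB _ _) _.
  by rewrite normrZ ger0_norm// subr_ge0.
have D_triangle r s t : D r t <= D r s + D s t.
  apply: le_trans (ler_normD _ _); rewrite le_eqVlt; apply/orP; left.
  apply/eqP; congr `| _ |.
  have -> : t - r = (s - r) + (t - s) by ring.
  have -> : f t - f r = (f s - f r) + (f t - f s) by rewrite [RHS]addrC subrKA.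
  by rewrite scalerDl opprD addrACA.
(* Points of differentiability account for [e * (b - a)]; crossing [Z] costs [e] for the variation
   of [f] and [e] for that of the affine map. *)
suff key e : 0 < e -> D a b <= e * (b - a + 2).
  apply/eqP; rewrite -subr_eq0 -normr_le0.
  apply/ler_addgt0Pr => e e0; rewrite add0r.
  have p : 0 < b - a + 2 by lra.
  by have := key _ (divr_gt0 e0 p); rewrite divfK ?gt_eqF.
move=> e0.
have [d d0 acd] := acf _ e0.
have w1 : 0 < `|w| + 1 by apply: ltr_wpDl.
(* Below [d], absolute continuity applies; below the quotient, total length times the norm of [w] is
   at most [e]. The [+ 1] covers [w = 0]. *)
have m0 : 0 < Num.min d (e / (`|w| + 1)) by rewrite lt_min d0 divr_gt0.
have [U [oU ZU mU]] := negligible_open_cover Z0 m0.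
pose P t := exists n (u v : nat -> R),
  [/\ forall k, (k < n)%N -> [/\ a <= u k, u k <= v k & v k <= t],
      forall k, (k < n)%N -> `]u k, v k[%classic `<=` U,
      trivIset `I_n (fun k => `]u k, v k[%classic) &
      D a t <= e * (t - a) +
        \sum_(k < n) (`|f (v k) - f (u k)| + (v k - u k) * `|w|)].
have [n [u [v [uv uvU tI Dab]]]] : P b.
  apply: (real_induction ab).
    exists 0%N, (fun=> 0), (fun=> 0); split=> //.
    by rewrite big_ord0 /D !subrr scale0r subrr normr0 mulr0 addr0.
  move=> c cab.
  have [Zc|nZc] := pselect (Z c); last first.
    (* Outside [Z], differentiability bounds the defect on both sides of [c], and the family of
       intervals stays the same. *)
    have [r r0 fr] := df c cab nZc _ e0.
    exists r => // s t as_ sc ct tb cs tc [n [u [v [uv uvU tI Das]]]].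
    exists n, u, v; split=> //.
      by move=> k /uv [? ? ?]; split=> //; apply: le_trans (le_trans sc ct).
    have Dsc : D s c <= e * (c - s).
      have -> : D s c = `|f s - f c - (s - c) *: w|.
        by rewrite /D -(opprB (f s)) -(opprB s) scaleNr -opprD normrN.
      by have := fr s; rewrite distrC ger0_norm ?subr_ge0//; apply; lra.
    have Dct : D c t <= e * (t - c).
      by have := fr t; rewrite ger0_norm ?subr_ge0//; apply; lra.
    have := D_triangle a s t; have := D_triangle s c t.
    by lra.
  (* At a point of [Z], the crossed interval ]s, t[ lies in [U] and joins the family as its last
     member. *)
  have [r /= r0 rU] := (nbhs_ballP c U).1 (open_nbhs_nbhs (conj oU (ZU _ Zc))).
  exists r => // s t as_ sc ct tb cs tc [n [u [v [uv uvU tI Das]]]].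
  have st : s <= t by apply: le_trans ct.
  exists n.+1, (fun k => if (k < n)%N then u k else s),
    (fun k => if (k < n)%N then v k else t); split.
  - move=> k _; case: ifP => [/uv [? ? vs]|_]; split=> //.
    exact: le_trans vs st.
  - move=> k _; case: ifP => [/uvU //|_] y /=; rewrite in_itv /= => syt.
    have /andP[sy yt] := syt; apply: rU; rewrite /ball /= ltr_norml.
    by apply/andP; split; lra.
  - move=> k l; rewrite /= !ltnS => k_le l_le.
    case: (ltnP k n) => kn; case: (ltnP l n) => ln.
    + exact: tI.
    + move=> [y [/=]]; rewrite !in_itv /= => /andP[_ yv] /andP[sy _].
      have [_ _ vs] := uv _ kn; have := lt_trans (lt_le_trans yv vs) sy.
      by rewrite ltxx.
    + move=> [y [/=]]; rewrite !in_itv /= => /andP[sy _] /andP[_ yv].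
      have [_ _ vs] := uv _ ln; have := lt_trans (lt_le_trans yv vs) sy.
      by rewrite ltxx.
    + by move=> _; apply/eqP; rewrite eqn_leq !(leq_trans _ ln, leq_trans _ kn).
  - rewrite big_ord_recr /= ltnn.
    under eq_bigr => k _ do rewrite ltn_ord.
    have := D_triangle a s t; have := D_le _ _ st.
    have : e * (s - a) <= e * (t - a) by rewrite ler_pM2l//; lra.
    lra.
have uvd : \sum_(k < n) (v k - u k) < Num.min d (e / (`|w| + 1)).
  rewrite -lte_fin; apply: le_lt_trans mU.
  apply: sum_disjoint_itv_le => //.
    exact: measurable_realfun.open_measurable.
  by move=> k /uv[].
move: uvd; rewrite lt_min => /andP[uvd uve].
have := acd n u v uv tI uvd.
have : (\sum_(k < n) (v k - u k)) * `|w| <= e.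
  move: uve; rewrite ltr_pdivlMr// => uve.
  have : 0 <= \sum_(k < n) (v k - u k).
    by apply: sumr_ge0 => k _; rewrite subr_ge0; have [] := uv k (ltn_ord k).
  lra.
move: Dab; rewrite big_split /= -mulr_suml.
lra.
Qed.

Lemma is_derive_remainder (R : realType) (V : normedModType R) (f : R -> V)
    (t : R) (w : V) :
  is_derive t (1 : R) f w -> forall e : R, 0 < e ->
  exists2 d : R, 0 < d & forall y, `|y - t| < d ->
    `|f y - f t - (y - t) *: w| <= e * `|y - t|.
Proof.
move=> [df <-] e e0.
have : h^-1 *: (f (h *: (1 : R) + t) - f t) @[h --> (0 : R)^'] --> 'D_1 f t.
  exact: df.
move=> /cvgrPdist_le /(_ _ e0) [d /= d0 fd]; exists d => // y yt.
have [->|y_neq_t] := eqVneq y t.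
  by rewrite !subrr scale0r subrr !normr0 mulr0.
have h0 : y - t != 0 by rewrite subr_eq0.
have := fd (y - t); rewrite /= sub0r normrN => /(_ yt h0).
rewrite [(y - t) *: (1 : R)]mulr1 subrK => fy.
rewrite -[f y - f t](scalerKV h0) -scalerBr normrZ mulrC.
by rewrite ler_wpM2r// distrC.
Qed.

Lemma abs_continuous_dominated (R : realType) (V W : normedModType R) (a b : R)
    (f : R -> V) (g : R -> W) :
  (forall s t, `|g s - g t| <= `|f s - f t|) ->
  abs_continuous a b f -> abs_continuous a b g.
Proof.
move=> gf acf e e0; have [d d0 fd] := acf _ e0; exists d => // n u v uv tI uvd.
by apply: le_lt_trans (fd n u v uv tI uvd); apply: ler_sum => k _.
Qed.

Lemma norm_fst_le (R : realType) (V W : normedModType R) (u : V * W) :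
  `|u.1| <= `|u|.
Proof. by rewrite prod_normE le_max lexx. Qed.

Lemma norm_snd_le (R : realType) (V W : normedModType R) (u : V * W) :
  `|u.2| <= `|u|.
Proof. by rewrite prod_normE le_max lexx orbT. Qed.

(** * Hybrid time domains *)

(** A normal form for all shapes of a domain. Only the last interval may be half-open or unbounded,
    so one followed by a later interval is the full closed interval between its switching times. *)
Lemma hybrid_time_domain_switch (R : realType) (E : set (R * nat)) :
  hybrid_time_domain E ->
  exists t : nat -> R,
    [/\ t 0%N = 0, {homo t : j k / (j <= k)%N >-> j <= k},
        forall s j, E (s, j) -> t j <= s,
        forall r s j, E (s, j) -> t j <= r <= s -> E (r, j) &
        forall r s j k, E (s, k) -> (j < k)%N ->
          E (r, j) <-> t j <= r <= t j.+1].
Proof.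
move=> [t [t0 tS Et]]; exists t; split=> //.
- by apply: homo_leq => //; exact: le_trans.
- move=> s j; case: Et => [->|[J [I [tI ->]]]].
    by move=> [k _ [/= + ->]]; rewrite in_itv => /andP[].
  case=> [[k _ [/= + ->]]|[/= + ->]]; first by rewrite in_itv => /andP[].
  by case: tI => -> /=; rewrite in_itv /= => /andP[].
- move=> r s j; case: Et => [->|[J [I [tI ->]]]].
    move=> [k _ [/= + jk]]; rewrite -jk in_itv /= => /andP[_ st] /andP[tr rs].
    by exists j => //; split=> //=; rewrite in_itv /= tr (le_trans rs).
  case=> [[k kJ [/= + jk]]|[/= + jk]].
    rewrite -jk in_itv /= => /andP[_ st] /andP[tr rs].
    left; exists j => //; first by rewrite jk.
    by split=> //=; rewrite in_itv /= tr (le_trans rs).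
  move=> sI /andP[tr rs]; right; split=> //=; move: tr sI; rewrite jk => tr.
  case: tI => -> /=; rewrite !in_itv /= tr //=.
    by move=> /andP[_]; exact: le_trans.
  by move=> /andP[_]; exact: le_lt_trans.
- move=> r s j k; case: Et => [->|[J [I [tI ->]]]].
    move=> _ _; split=> [[l _ [/= + ->]]|rt]; first by rewrite in_itv.
    by exists j => //; split=> //=; rewrite in_itv.
  move=> Esk jk; have jJ : (j < J)%N.
    apply: (leq_trans jk); case: Esk => [[l lJ [_ /= ->]]|[_ /= ->//]].
    exact: ltnW.
  split=> [[[l _ [/= + ->]]|[_ /= jJ']]|rt]; first by rewrite in_itv.
    by move: jJ; rewrite jJ' ltnn.
  by left; exists j => //; split=> //=; rewrite in_itv.
Qed.

Lemma hybrid_domain_le (R : realType) (E : set (R * nat)) s t j k :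
  hybrid_time_domain E -> E (s, j) -> E (t, k) -> (j < k)%N -> s <= t.
Proof.
move=> /hybrid_time_domain_switch[tau [_ tau_homo tau_le _ tau_iff]].
move=> Es Et jk; have /andP[_ sj] := (tau_iff s t j k Et jk).1 Es.
apply: le_trans sj (le_trans (tau_homo _ _ jk) _); exact: tau_le Et.
Qed.

Lemma hybrid_domain_convex (R : realType) (E : set (R * nat)) r s t j :
  hybrid_time_domain E -> E (s, j) -> E (t, j) -> s <= r <= t -> E (r, j).
Proof.
move=> /hybrid_time_domain_switch[tau [_ _ tau_le tau_conv _]] Es Et.
move=> /andP[sr rt]; apply: (tau_conv _ _ _ Et); rewrite rt andbT.
exact: le_trans (tau_le _ _ Es) sr.
Qed.

Lemma hybrid_domain_start (R : realType) (E : set (R * nat)) t :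
  hybrid_time_domain E -> E (t, 0%N) -> 0 <= t.
Proof.
move=> /hybrid_time_domain_switch[tau [tau0 _ tau_le _ _]] /tau_le.
by rewrite tau0.
Qed.

(** The witness is the switching time. Inductions on the jump number use it: an invariant crosses
    the jump at [s], then follows the flow from [s] to [t]. *)
Lemma hybrid_domain_pred (R : realType) (E : set (R * nat)) t j :
  hybrid_time_domain E -> E (t, j.+1) ->
  exists s, [/\ s <= t, E (s, j) & E (s, j.+1)].
Proof.
move=> /hybrid_time_domain_switch[tau [_ tau_homo tau_le tau_conv tau_iff]] Et.
exists (tau j.+1); split; first exact: tau_le Et.
  by apply: (tau_iff _ _ _ _ Et (ltnSn j)).2; rewrite lexx tau_homo.
by apply: (tau_conv _ _ _ Et); rewrite lexx (tau_le _ _ Et).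
Qed.

Lemma hybrid_domain_interior (R : realType) (E : set (R * nat)) s t j :
  hybrid_time_domain E -> E (s, j) -> E (t, j) -> s < t ->
  interior (time_slice E j) !=set0.
Proof.
move=> domE Es Et st; exists ((s + t) / 2).
suff slice : `[s, t]%classic `<=` time_slice E j.
  by apply: (interiorS slice); rewrite interior_itv_bnd /= in_itv /= !midf_lt.
by move=> r; rewrite /= in_itv; exact: hybrid_domain_convex domE Es Et.
Qed.

(** * Explicit flow between jumps *)

(** Almost everywhere [q] has derivative 0, hence it is constant; then [x] has a constant
    derivative. Both are instances of [abs_continuous_ae_affine]. *)
Lemma hybrid_solution_flow (R : realType) (N : nat) (L : 'M[R]_N) (Delta : R)
    (E : set (R * nat)) (z : R -> nat -> state R N) s t j :
  hybrid_solution L Delta E z -> E (s, j) -> E (t, j) -> s <= t ->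
  (z t j).2 = (z s j).2 /\
  (z t j).1 = (z s j).1 - (t - s) *: (L *m (z s j).2).
Proof.
move=> sol Es Et; rewrite le_eqVlt => /predU1P[<-|st].
  by rewrite subrr scale0r subr0.
have slice : `[s, t]%classic `<=` time_slice E j.
  move=> r; rewrite /= in_itv.
  exact: hybrid_domain_convex (sol_dom sol) Es Et.
have Z0 := sol_flow sol (hybrid_domain_interior (sol_dom sol) Es Et st).
have sub a b c : s <= a <= b -> b <= t -> a <= c <= b -> time_slice E j c.
  move=> /andP[sa ab] bt /andP[ac cb]; apply: slice.
  by rewrite /= in_itv /= (le_trans sa ac) (le_trans cb bt).
have ac b : s <= b -> b <= t -> abs_continuous s b (fun r => z r j).
  move=> sb bt; apply: (sol_abs_cont sol) => // c; rewrite /= in_itv => scb.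
  by apply: (sub s b) => //; rewrite lexx.
have q_cst b : s <= b -> b <= t -> (z b j).2 = (z s j).2.
  move=> sb bt; apply/eqP; rewrite -subr_eq0; apply/eqP.
  rewrite -[RHS](scaler0 _ (b - s)).
  apply: (abs_continuous_ae_affine (f := fun r => (z r j).2) sb _ Z0).
    apply: abs_continuous_dominated (ac b sb bt) => u v.
    exact: norm_snd_le (z u j - z v j).
  move=> c scb /contrapT /= Zc e e0.
  have Ec : time_slice E j c by apply: (sub s b) => //; rewrite lexx.
  have [d d0 zd] := is_derive_remainder (Zc Ec) e0.
  exists d => // y /zd; apply: le_trans.
  exact: norm_snd_le (z y j - z c j - (y - c) *: flow_map L (z c j)).
split; first exact: q_cst (ltW st) (lexx t).
apply/eqP; rewrite addrC -subr_eq -scalerN; apply/eqP.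
apply: (abs_continuous_ae_affine (f := fun r => (z r j).1) (ltW st) _ Z0).
  apply: abs_continuous_dominated (ac t (ltW st) (lexx t)) => u v.
  exact: norm_fst_le (z u j - z v j).
move=> c stc /contrapT /= Zc e e0.
have Ec : time_slice E j c by exact: slice.
have [d d0 zd] := is_derive_remainder (Zc Ec) e0.
exists d => // y /zd; apply: le_trans.
(* Constancy of [q] replaces the slope at [c] by the slope at [s]. *)
have /andP[sc ct] := stc; rewrite -(q_cst c sc ct).
exact: norm_fst_le (z y j - z c j - (y - c) *: flow_map L (z c j)).
Qed.

(** * Grid, norms and Laplacian *)

Lemma grid_half_integer (R : realType) (Delta r : R) :
  grid Delta r -> exists k : int, r = Delta / 2 * k%:~R.
Proof.
move=> [k [->|->]].
  by exists (k * 2); rewrite intrM; field.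
by exists (k * 2 + 1); rewrite intrD intrM; field.
Qed.

Lemma half_integer_lt (R : realType) (h : R) (k l : int) : 0 < h ->
  h * k%:~R < h * l%:~R -> h * k%:~R <= h * l%:~R - h.
Proof.
move=> h0; rewrite ltr_pM2l// ltr_int => kl.
have : (k + 1)%:~R <= l%:~R :> R by rewrite ler_int lezD1.
by rewrite -(ler_pM2l h0) intrD mulrDr mulr1; lra.
Qed.

Lemma cV_norm_entry (R : realType) (N : nat) (v : 'cV[R]_N) i :
  `|v i 0| <= `|v|.
Proof.
rewrite [`|v|]mx_normrE.
exact: (le_bigmax _ (fun ij : 'I_N * 'I_1 => `|v ij.1 ij.2|) (i, 0)).
Qed.

(** The norm of a nonzero vector is attained at an entry. Being a grid point, it can serve as the
    level of the maximum principle. *)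
Lemma cV_norm_half_integer (R : realType) (N : nat) (h : R) (v : 'cV[R]_N) :
  0 < h -> (forall i, exists k : int, v i 0 = h * k%:~R) ->
  exists a : nat, `|v| = h * a%:R.
Proof.
move=> h0 vh; have [->|v0] := eqVneq v 0.
  by exists 0%N; rewrite normr0 mulr0.
have : mx_norm v != 0 by rewrite -[mx_norm v]/(`|v|) normr_eq0.
move=> /mx_norm_neq0[[i l] /= vE]; have [k vk] := vh i.
exists `|k|%N; rewrite [LHS]vE (ord1 l) vk normrM gtr0_norm//.
by rewrite -intr_norm natr_absz.
Qed.

(** Zero row sums turn the product into weighted differences, all nonnegative at an agent where [v]
    is maximal. *)
Lemma mulmx_laplacianE (R : realType) (N : nat) (G : wdigraph R N)
    (v : 'cV[R]_N) i :
  (laplacian G *m v) i 0 = \sum_j adj G i j * (v i 0 - v j 0).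
Proof.
rewrite /laplacian mulmxBl mul_diag_mx !mxE mulr_suml -sumrB.
by apply: eq_bigr => j _; rewrite mxE mulr1 mulrBr.
Qed.

Lemma adj_ge0 (R : realType) (N : nat) (G : wdigraph R N) i j : 0 <= adj G i j.
Proof.
by have [/adj_gt0/ltW //|/adj_eq0 ->] := boolP (edge G j i).
Qed.

Lemma mulmx_row_sum_norm (R : realType) (m n : nat) (A : 'M[R]_(m, n))
    (v : 'cV[R]_n) (c : R) i :
  0 <= c -> (forall j, `|v j 0| <= c) ->
  `|(A *m v) i 0| <= row_sum_norm A * c.
Proof.
move=> c0 vc; rewrite mxE; apply: le_trans (ler_norm_sum _ _ _) _.
apply: (@le_trans _ _ ((\sum_j `|A i j|) * c)).
  by rewrite mulr_suml; apply: ler_sum => j _; rewrite normrM ler_wpM2l.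
apply: ler_wpM2r => //.
exact: (le_bigmax _ (fun i => \sum_j `|A i j|) i).
Qed.

(** * From hybrid solutions to quantized trajectories *)

(** The flow set gives the bound at all times of an interval but the last, where continuity
    preserves it. At a jump, [q_i] stays or moves by [Delta / 2] towards [x_i]; this also serves
    later intervals reduced to a point. *)
Lemma hybrid_solution_saturation (R : realType) (N : nat) (L : 'M[R]_N)
    (Delta : R) (E : set (R * nat)) (z : R -> nat -> state R N) t j i :
  0 < Delta -> hybrid_solution L Delta E z -> initial_set Delta (z 0 0%N) ->
  E (t, j) -> `|(z t j).1 i 0 - (z t j).2 i 0| <= Delta / 2.
Proof.
move=> Delta0 sol [_ init].
have flow s u k : E (s, k) -> E (u, k) -> s < u ->
    `|(z u k).1 i 0 - (z u k).2 i 0| <= Delta / 2.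
  move=> Es Eu su.
  set c := (L *m (z s k).2) i 0.
  apply/ler_addgt0Pr => e e0.
  have c1 : 0 < `|c| + 1 by apply: ltr_wpDl.
  (* A time of the interval before [u], after which [x_i] moves by at most [e]. *)
  pose r := Num.max s (u - e / (`|c| + 1)).
  have sr : s <= r by rewrite le_max lexx.
  have ru : r < u by rewrite gt_max su ltrBlDr ltrDl divr_gt0.
  have uc : (u - r) * `|c| <= e.
    have ur : u - r <= e / (`|c| + 1).
      by rewrite lerBlDr addrC -lerBlDr le_max lexx orbT.
    have : (u - r) * (`|c| + 1) <= e by rewrite -ler_pdivlMr.
    by rewrite mulrDr mulr1; lra.
  have Er : E (r, k).
    by apply: hybrid_domain_convex (sol_dom sol) Es Eu _; rewrite sr ltW.
  have [_ /(_ i) /andP[]] : flow_set Delta (z r k).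
    apply: (sol_flow_set sol) => //.
      exact: hybrid_domain_interior (sol_dom sol) Es Eu su.
    apply: (@lt_le_trans _ _ u%:E); first by rewrite lte_fin.
    by apply: ereal_sup_ubound; exists u.
  have [qu xu] := hybrid_solution_flow sol Es Eu (ltW su).
  have [qr xr] := hybrid_solution_flow sol Es Er sr.
  have -> : (z u k).1 i 0 = (z r k).1 i 0 - (u - r) * c.
    rewrite xu xr mxE mxE mxE -/c [in RHS]mxE [in RHS]mxE [in RHS]mxE -/c.
    by ring.
  rewrite qu qr => lo hi.
  have : `|(z r k).1 i 0 - (z s k).2 i 0| <= Delta / 2.
    by rewrite ler_norml; apply/andP; split; lra.
  have := ler_normB ((z r k).1 i 0 - (z s k).2 i 0) ((u - r) * c).
  rewrite [in X in _ <= X]normrM (ger0_norm (_ : 0 <= u - r)).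
    by rewrite addrAC; lra.
  by rewrite subr_ge0 ltW.
elim: j t => [|j IH] t Et.
  have := hybrid_domain_start (sol_dom sol) Et.
  rewrite le_eqVlt => /predU1P[<-|].
    have /andP[lo hi] := init i.
    by rewrite ler_norml; apply/andP; split; lra.
  exact: flow (sol_dom0 sol) Et.
have [s [+ Es EsS]] := hybrid_domain_pred (sol_dom sol) Et.
rewrite le_eqVlt => /predU1P[<-|]; last exact: flow EsS Et.
have [_ ->] := sol_jump sol Es EsS.
have := IH s Es; rewrite ler_norml /jump_map mxE /= => /andP[lo hi].
by rewrite ler_norml; apply/andP; split;
  case: ifP => ?; try case: ifP => ?; lra.
Qed.

(* Unlike the jump map, these properties of a solution are invariant
   under [(x, q) |-> (- x, - q)], so that the upper bound on [q] also yields the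
   lower one. *)
Record quantized_trajectory (R : realType) (N : nat) (L : 'M[R]_N) (Delta : R)
    (E : set (R * nat)) (x q : R -> nat -> 'cV[R]_N) : Prop :=
  QuantizedTrajectory {
  traj_dom : hybrid_time_domain E ;
  traj_dom0 : E (0, 0%N) ;
  traj_grid : forall t j i, E (t, j) ->
    exists k : int, q t j i 0 = Delta / 2 * k%:~R ;
  traj_flow : forall s t j, E (s, j) -> E (t, j) -> s <= t ->
    q t j = q s j /\ x t j = x s j - (t - s) *: (L *m q s j) ;
  traj_jump_x : forall t j, E (t, j) -> E (t, j.+1) -> x t j.+1 = x t j ;
  traj_jump_q : forall t j i, E (t, j) -> E (t, j.+1) ->
    q t j.+1 i 0 = q t j i 0 \/
    `|x t j i 0 - q t j i 0| = Delta / 2 /\ q t j.+1 i 0 = x t j i 0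
}.

(** Saturation turns the inequalities that trigger a jump into equalities, so a changing [q_i] lands
    exactly on [x_i]. *)
Lemma hybrid_solution_trajectory (R : realType) (N : nat) (L : 'M[R]_N)
    (Delta : R) (E : set (R * nat)) (z : R -> nat -> state R N) :
  0 < Delta -> hybrid_solution L Delta E z -> initial_set Delta (z 0 0%N) ->
  quantized_trajectory L Delta E (fun t j => (z t j).1) (fun t j => (z t j).2).
Proof.
move=> Delta0 sol init; split.
- exact: sol_dom sol.
- exact: sol_dom0 sol.
- by move=> t j i Et; apply: grid_half_integer; exact: (sol_state sol Et).
- by move=> s t j; exact: (hybrid_solution_flow sol).
- by move=> t j Et EtS; have [_ ->] := sol_jump sol Et EtS.
- move=> t j i Et EtS; have [_ ->] := sol_jump sol Et EtS.
  have := hybrid_solution_saturation i Delta0 sol init Et.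
  rewrite ler_norml /jump_map mxE /= => /andP[lo hi].
  case: ifP => [up|_]; last case: ifP => [down|_]; [right|right|by left].
    have -> : (z t j).1 i 0 = (z t j).2 i 0 + Delta / 2 by lra.
    by split=> //; rewrite [X in `|X|]addrC addKr gtr0_norm//; lra.
  have -> : (z t j).1 i 0 = (z t j).2 i 0 - Delta / 2 by lra.
  by split=> //; rewrite [X in `|X|]addrC addKr normrN gtr0_norm//; lra.
Qed.

Lemma quantized_trajectory_opp (R : realType) (N : nat) (L : 'M[R]_N)
    (Delta : R) (E : set (R * nat)) (x q : R -> nat -> 'cV[R]_N) :
  quantized_trajectory L Delta E x q ->
  quantized_trajectory L Delta E (fun t j => - x t j) (fun t j => - q t j).
Proof.
move=> traj; split.
- exact: traj_dom traj.
- exact: traj_dom0 traj.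
- move=> t j i Et; have [k qk] := traj_grid traj i Et.
  by exists (- k); rewrite mxE qk mulrNz mulrN.
- move=> s t j Es Et st; have [-> ->] := traj_flow traj Es Et st.
  by rewrite mulmxN scalerN opprD.
- by move=> t j Et EtS; rewrite (traj_jump_x traj Et EtS).
- move=> t j i Et EtS; rewrite !mxE -opprD normrN.
  by have [->|[-> ->]] := traj_jump_q traj i Et EtS; [left|right].
Qed.

(** * Maximum principle and dwell time *)

(** The clause on [x] makes the bound inductive: at level [M] it rules out an upward jump. Below [M]
    the grid leaves a gap of [Delta / 2], so a jump ends at most at [M], and then with [x_i = M],
    which restores the clause. *)
Lemma quantized_trajectory_max (R : realType) (N : nat) (G : wdigraph R N)
    (Delta : R) (E : set (R * nat)) (x q : R -> nat -> 'cV[R]_N) (m : int) t j :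
  let M := Delta / 2 * m%:~R in
  0 < Delta -> quantized_trajectory (laplacian G) Delta E x q ->
  (forall i, q 0 0%N i 0 <= M /\
     (q 0 0%N i 0 = M -> x 0 0%N i 0 < M + Delta / 2)) ->
  E (t, j) ->
  forall i, q t j i 0 <= M /\ (q t j i 0 = M -> x t j i 0 < M + Delta / 2).
Proof.
move=> M Delta0 traj init.
pose inv s k := forall i,
  q s k i 0 <= M /\ (q s k i 0 = M -> x s k i 0 < M + Delta / 2).
have flow s u k : E (s, k) -> E (u, k) -> s <= u -> inv s k -> inv u k.
  move=> Es Eu su invs i; have [-> ->] := traj_flow traj Es Eu su.
  have [qM xM] := invs i; split=> // qi; rewrite mxE mxE mxE mulmx_laplacianE.
  apply: le_lt_trans (xM qi); rewrite gerBl mulr_ge0 ?subr_ge0//.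
  apply: sumr_ge0 => l _; rewrite mulr_ge0 ?adj_ge0// subr_ge0 qi.
  by have [] := invs l.
elim: j t => [|j IH] t Et.
  exact: flow (traj_dom0 traj) Et (hybrid_domain_start (traj_dom traj) Et) init.
have [s [st Es EsS]] := hybrid_domain_pred (traj_dom traj) Et.
apply: (flow _ _ _ EsS Et st) => i; have [qM xM] := IH s Es i.
rewrite (traj_jump_x traj Es EsS).
have [->//|[xq ->]] := traj_jump_q traj i Es EsS.
have xq' : x s j i 0 <= q s j i 0 + Delta / 2.
  by have := ler_norm (x s j i 0 - q s j i 0); lra.
have h0 : 0 < Delta / 2 by rewrite divr_gt0.
move: qM; rewrite le_eqVlt => /predU1P[qi|qi].
  have xi := xM qi; have xE : x s j i 0 = M - Delta / 2.
    by move: xq; rewrite qi; case: ger0P => *; lra.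
  by rewrite xE; split=> [|?]; lra.
have [k qk] := traj_grid traj i Es.
have := half_integer_lt h0; move=> /(_ k m); rewrite -qk -/M => /(_ qi) ?.
by split=> [|->]; lra.
Qed.

(** Any two changes are covered: a change in between already forces [x_i] to have drifted by
    [Delta / 2] since [s]. *)
Lemma quantized_trajectory_dwell (R : realType) (N : nat) (L : 'M[R]_N)
    (Delta c : R) (E : set (R * nat)) (x q : R -> nat -> 'cV[R]_N) s t j k i :
  0 <= c -> quantized_trajectory L Delta E x q ->
  (forall u l, E (u, l) -> forall h, `|q u l h 0| <= c) ->
  E (s, j) -> E (s, j.+1) -> q s j.+1 i 0 <> q s j i 0 ->
  E (t, k) -> E (t, k.+1) -> q t k.+1 i 0 <> q t k i 0 ->
  (j < k)%N -> Delta / 2 <= row_sum_norm L * c * (t - s).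
Proof.
move=> c0 traj qc Es EsS q_s Et EtS q_t jk; set C := row_sum_norm L * c.
have C0 u l : E (u, l) -> `|(L *m q u l) i 0| <= C.
  by move=> Eul; apply: mulmx_row_sum_norm => //; exact: qc.
have C_ge0 : 0 <= C by apply: le_trans (C0 _ _ Es).
have [_ xs] : `|x s j i 0 - q s j i 0| = Delta / 2 /\ q s j.+1 i 0 = x s j i 0.
  by have [] := traj_jump_q traj i Es EsS.
(* Either the bound is already reached, or [q_i] still has the value it took at [s] and [x_i] has
   drifted from it at speed at most [C]. *)
pose p u l := Delta / 2 <= C * (u - s) \/
  (q u l i 0 = x s j i 0 /\ `|x u l i 0 - x s j i 0| <= C * (u - s)).
have flow u v l : E (u, l) -> E (v, l) -> u <= v -> p u l -> p v l.
  move=> Eu Ev uv; have [qE xE] := traj_flow traj Eu Ev uv.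
  have uvC : C * (u - s) <= C * (v - s) by apply: ler_wpM2l => //; lra.
  case=> [?|[qu xu]]; [by left; lra|right; rewrite qE; split=> //].
  rewrite xE mxE mxE mxE addrAC; apply: le_trans (ler_normB _ _) _.
  have : `|(v - u) * (L *m q u l) i 0| <= (v - u) * C.
    by rewrite normrM ger0_norm ?subr_ge0// ler_wpM2l ?subr_ge0// C0.
  by lra.
suff P d u : E (u, (j.+1 + d)%N) -> p u (j.+1 + d)%N.
  have := P (k - j.+1)%N t; rewrite subnKC// => /(_ Et).
  (* In the second case the saturated distance [Delta / 2] at [t] is exactly the drift of [x_i]
     since [s]. *)
  case=> // -[qk xk].
  have [//|[xq _]] := traj_jump_q traj i Et EtS.
  by move: xq; rewrite qk => <-.
elim: d u => [|d IH] u; rewrite ?addn0 ?addnS => Eu.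
  have su := hybrid_domain_le (traj_dom traj) Es Eu (ltnSn j).
  apply: (flow _ _ _ EsS Eu su); right; rewrite xs (traj_jump_x traj Es EsS).
  by rewrite !subrr normr0 mulr0.
have [v [vu Ev EvS]] := hybrid_domain_pred (traj_dom traj) Eu.
apply: (flow _ _ _ EvS Eu vu).
case: (IH v Ev) => [?|[qv xv]]; first by left.
have [qv'|[xq _]] := traj_jump_q traj i Ev EvS; last by left; rewrite -xq qv.
by right; rewrite qv' (traj_jump_x traj Ev EvS).
Qed.

(** * Positivity of the Laplacian norm and counting of values *)

(** A path between two distinct nodes yields an edge, whose weight is up to sign an off-diagonal
    entry. This makes [T] positive; with norm 0 the division would default to 0. *)
Lemma row_sum_norm_laplacian_gt0 (R : realType) (N : nat) (G : wdigraph R N) :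
  (2 <= N)%N -> weakly_connected G -> 0 < row_sum_norm (laplacian G).
Proof.
move=> N2 conn.
have [u [v uv]] : exists u v, edge G v u.
  pose i0 : 'I_N := Ordinal (ltnW N2); pose i1 : 'I_N := Ordinal N2.
  have /connectP[[|y p] /= + i1E] := conn i0 i1.
    by have := congr1 val i1E.
  by move=> /andP[/orP[e|e] _]; [exists y, i0|exists i0, y].
have vu : u != v by apply: contraTneq uv => ->; rewrite edge_irr.
apply: (@lt_le_trans _ _ `|laplacian G u v|).
  rewrite /laplacian !mxE (negbTE vu) mulr0n sub0r normrN normr_gt0.
  by rewrite gt_eqF// adj_gt0.
apply: le_trans (le_bigmax _ (fun i => \sum_j `|laplacian G i j|) u).
by rewrite (bigD1 v)//= lerDl sumr_ge0.
Qed.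

Lemma log2_ge0 (R : realType) (r : R) : 1 <= r -> 0 <= log2 r.
Proof. by move=> r1; rewrite divr_ge0 ?ln_ge0// ler1n. Qed.

Lemma ceil_log2_ge0 (R : realType) (r : R) :
  1 <= r -> 0 <= Num.ceil (log2 r).
Proof.
by move=> r1; rewrite -(ler0z R); apply: le_trans (log2_ge0 r1) (ceil_ge _).
Qed.

Lemma le_exp2_ceil_log2 (R : realType) (r : R) :
  1 <= r -> r <= 2 ^+ `|Num.ceil (log2 r)|%N.
Proof.
move=> r1; have r0 : 0 < r by exact: lt_le_trans r1.
have ln2 : 0 < ln (2 : R) by rewrite ln_gt0 ?ltr1n.
rewrite -ler_ln ?posrE ?exprn_gt0// lnXn// -[X in _ <= X]mulr_natl.
by rewrite -ler_pdivrMr// natr_absz ger0_norm ?ceil_log2_ge0// ceil_ge.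
Qed.

Lemma card_half_integers (R : realType) (h : R) (lo : int) (n : nat)
    (A : set R) :
  (forall r, A r -> exists2 k : int, r = h * k%:~R & lo <= k < lo + n%:Z) ->
  (A #<= `I_n)%card.
Proof.
move=> Ah; pose f (l : nat) : R := h * (lo + l%:Z)%:~R.
apply: card_le_trans (card_image_le f `I_n).
apply: subset_card_le => r /Ah[k -> /andP[lok kn]].
by exists `|k - lo|%N; rewrite /= /f; [lia|congr (_ * _%:~R); lia].
Qed.

Theorem mainTheorem6 (R : realType) (N : nat) (N_ge2 : (2 <= N)%N)
    (G : wdigraph R N) (G_connected : weakly_connected G)
    (G_balanced : weight_balanced G) (Delta : R) (Delta_gt0 : 0 < Delta)
    (E : set (R * nat)) (z : R -> nat -> state R N)
    (z_solution : hybrid_solution (laplacian G) Delta E z)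
    (z_complete : complete_domain E)
    (z_initial : initial_set Delta (z 0 0%N)) :
  let L := laplacian G in
  let q0 : 'cV[R]_N := (z 0 0%N).2 in
  let T := dwell_time L Delta q0 in
  let B := num_bits Delta q0 in
  forall i : 'I_N,
    [/\ forall s t : R, consecutive_change_times E z i s t -> T <= t - s,
        (q_values E z i #<= `I_(2 ^ B))%card,
        (data_rate B E z i <= (B%:R / T)%:E)%E &
        B%:R / T = (Num.ceil (log2 (8 * (`|q0| / Delta) + 5)))%:~R
                   * (2 * (`|q0| / Delta) + 1) * row_sum_norm L].
Proof.
move=> L q0 T B i.
have traj := hybrid_solution_trajectory Delta_gt0 z_solution z_initial.
have h0 : 0 < Delta / 2 by rewrite divr_gt0.
have q0_grid l : exists k : int, q0 l 0 = Delta / 2 * k%:~R.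
  exact: (traj_grid traj l (traj_dom0 traj)).
have [a q0a] := cV_norm_half_integer h0 q0_grid.
have x0q0 l : q0 l 0 - Delta / 2 <= (z 0 0%N).1 l 0 < q0 l 0 + Delta / 2.
  by have [_] := z_initial; apply.
have q_le t j l : E (t, j) -> (z t j).2 l 0 <= `|q0|.
  move=> Et.
  (* Here [M] is the norm of [q0]; the strict clause on [x] comes from the right-hand inequality of
     [initial_set]. *)
  have := @quantized_trajectory_max _ _ _ _ _ _ _ a t j Delta_gt0 traj.
  rewrite -[X in Delta / 2 * X]/(a%:R) -q0a => /(_ _ Et l)[]// h.
  split; first by apply: le_trans (cV_norm_entry q0 h); exact: ler_norm.
  by move=> <-; have /andP[] := x0q0 h.
have q_ge t j l : E (t, j) -> - `|q0| - Delta / 2 <= (z t j).2 l 0.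
  move=> Et.
  (* After negation an agent may start with [x_i = q_i + Delta / 2], which can break the clause at
     level [a]; no entry of [- q0] reaches level [a + 1]. *)
  have := @quantized_trajectory_max _ _ _ _ _ _ _ (a%:Z + 1) t j
    Delta_gt0 (quantized_trajectory_opp traj).
  have -> : Delta / 2 * (a%:Z + 1)%:~R = `|q0| + Delta / 2.
    by rewrite intrD mulrDr mulr1 q0a.
  move=> /(_ _ Et l)[h|]; last by rewrite mxE; lra.
  have := cV_norm_entry q0 h; rewrite ler_norml !mxE -/q0 => /andP[q0h _].
  by split=> [|?]; lra.
have q_norm t j : E (t, j) -> forall l, `|(z t j).2 l 0| <= `|q0| + Delta / 2.
  move=> Et l; have := q_le t j l Et; have := q_ge t j l Et => ? ?.
  by rewrite ler_norml; apply/andP; split; lra.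
have q0_ge0 : 0 <= `|q0| by [].
have c0 : 0 < `|q0| + Delta / 2 by lra.
have L0 : 0 < row_sum_norm L by exact: row_sum_norm_laplacian_gt0.
have T0 : 0 < T by rewrite divr_gt0// mulr_gt0.
(* Stated for all pairs of changes, this serves change times and transmissions alike; as [T] is
   positive, no agent transmits twice at one time. *)
have dwell s t j k : q_changes E z i s j -> q_changes E z i t k -> (j < k)%N ->
    T <= t - s.
  move=> [Es EsS qs] [Et EtS qt] jk.
  rewrite ler_pdivrMr ?mulr_gt0// [X in _ <= X]mulrC.
  exact: (quantized_trajectory_dwell (ltW c0) traj q_norm Es EsS qs Et EtS qt).
have r1 : 1 <= 8 * (`|q0| / Delta) + 5.
  have : 0 <= `|q0| / Delta by rewrite divr_ge0// ltW.
  by lra.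
split.
- move=> s t [[j cs] [k ct] st _]; apply: (dwell _ _ _ _ cs ct).
  have [Es EsS _] := cs; have [Et _ _] := ct.
  (* The times order the jump numbers: [k <= j] would give [t <= s]. *)
  rewrite ltnNge; apply/negP; rewrite leq_eqVlt => /predU1P[kj|kj].
    rewrite kj in Et.
    have := hybrid_domain_le (sol_dom z_solution) Et EsS (ltnSn j).
    by rewrite leNgt st.
  have := hybrid_domain_le (sol_dom z_solution) Et Es kj.
  by rewrite leNgt st.
(* As the norm of [q0] is [Delta / 2 * a], the argument of the logarithm is [4 * a + 5]. *)
- have a_le : (4 * a + 5 <= 2 ^ B)%N.
    rewrite -(ler_nat R) natrX; apply: le_trans (le_exp2_ceil_log2 r1).
    rewrite q0a natrD natrM le_eqVlt; apply/orP; left; apply/eqP.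
    by field; rewrite gt_eqF.
  (* By [q_ge] and [q_le] the indices of the values run from [- a - 1] to [a]. *)
  apply: (@card_half_integers _ (Delta / 2) (- a%:Z - 1)).
  move=> r [[t j] Et <-] /=.
  have [k qk] := traj_grid traj i Et; exists k => //.
  have := q_le t j i Et; have := q_ge t j i Et; rewrite qk q0a => lo hi.
  have ka : (k <= a)%R by rewrite -(ler_int R) -(ler_pM2l h0).
  have ak : (- a%:Z - 1 <= k)%R.
    rewrite -(ler_int R) -(ler_pM2l h0) intrD rmorphN /= mulrDr mulrN1 mulrN.
    exact: lo.
  by apply/andP; split; lia.
- have delay : (T%:E <= min_transmission_delay E z i)%E.
    apply: le_ereal_inf_tmp => _ [s [t [[j [k [cs ct jk _]]] ->]]].
    by rewrite lee_fin; exact: dwell cs ct jk.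
  have -> : (B%:R / T)%:E = (B%:R%:E * (T%:E)^-1)%E.
    by rewrite inver gt_eqF.
  apply: lee_wpmul2l; first by rewrite lee_fin.
  (* Inversion is antitone on nonnegative extended reals; an infinite delay gives rate 0. *)
  rewrite lee_pV2// inE; last by rewrite lee_fin ltW.
  by apply: le_trans delay; rewrite lee_fin ltW.
- have -> : (B%:R : R) = (Num.ceil (log2 (8 * (`|q0| / Delta) + 5)))%:~R.
    by rewrite natr_absz ger0_norm// ceil_log2_ge0.
  rewrite /T /dwell_time -!mulrA; congr (_ * _).
  by field; rewrite !gt_eqF//; lra.
Qed.
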